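(* Let $G$ be a graph. Then $G$ is a Cayley graph of a cancellative monoid (that is, $G=\mathcal{C}\langle M,Q\rangle$ for some cancellative monoid $M$, some subset $Q\subseteq M$ generating $M$ as a monoid, and some injective labeling $\langle\,\rangle:Q\to A$) if and only if $G$ is rooted, simple, deterministic, co-deterministic and arc-symmetric.
   Context: A graph (over a label set $A$) is a non-empty set $G\subseteq V\times A\times V$ of labeled edges; $(s,a,t)\in G$ is written $s\xrightarrow{a}_G t$. $V_G$ is the set of vertices occurring in edges, $A_G$ the set of edge labels. For a magma $(M,\cdot)$, $Q\subseteq M$ and injective $\langle\,\rangle:Q\to A$, $\mathcal{C}\langle M,Q\rangle=\{(p,\langle q\rangle,p\cdot q): p\in M,\ q\in Q\}$. A magma is cancellative if both $r\cdot p=r\cdot q\Rightarrow p=q$ and $p\cdot r=q\cdot r\Rightarrow p=q$. $G$ is simple if no two edges share source and target; deterministic if $r\xrightarrow{a}s$ and $r\xrightarrow{a}t$ imply $s=t$; co-deterministic if $s\xrightarrow{a}r$ and $t\xrightarrow{a}r$ imply $s=t$; rooted if some vertex reaches every vertex by a directed path. For a vertex $s$, $G_{\downarrow s}$ is the subgraph induced by the vertices reachable from $s$; $G$ is arc-symmetric if for all $s,t\in V_G$ there is an isomorphism of labeled graphs from $G_{\downarrow s}$ to $G_{\downarrow t}$ mapping $s$ to $t$. *)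

(* Defs.v *)
From Stdlib Require Import Relation_Operators.
From mathcomp Require Import all_boot.
From mathcomp Require Import boolp classical_sets functions.

Set Implicit Arguments.
Unset Strict Implicit.
Unset Printing Implicit Defensive.

Local Open Scope classical_set_scope.

(* A graph is a set of labeled edges; its non-emptiness is a separate
   hypothesis, since [reach_graph G s] is empty when [s] is a sink. *)
Definition edge_set (V A : Type) := set (V * A * V).

Section Graphs.
Variables V A : Type.
Implicit Types G H : edge_set V A.

Definition vertices G : set V :=
  [set v | exists a w, G (v, a, w) \/ G (w, a, v)].

Definition simple G :=
  forall s t a b, G (s, a, t) -> G (s, b, t) -> a = b.

Definition deterministic G :=
  forall r a s t, G (r, a, s) -> G (r, a, t) -> s = t.

Definition codeterministic G :=
  forall r a s t, G (s, a, r) -> G (t, a, r) -> s = t.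

Definition reach G : V -> V -> Prop :=
  clos_refl_trans V (fun s t => exists a, G (s, a, t)).

Definition rooted G :=
  exists2 r, vertices G r & forall s, vertices G s -> reach G r s.

Definition induced G (P : set V) : edge_set V A :=
  [set e | [/\ G e, P e.1.1 & P e.2]].

Definition reach_graph G (s : V) : edge_set V A := induced G (reach G s).

(* [f] is total on [V], but only its restriction to [vertices G] matters. *)
Definition graph_iso G H (f : V -> V) :=
  set_bij (vertices G) (vertices H) f /\
  forall s a t, vertices G s -> vertices G t ->
    (G (s, a, t) <-> H (f s, a, f t)).

Definition arc_symmetric G :=
  forall s t, vertices G s -> vertices G t ->
    exists2 f, graph_iso (reach_graph G s) (reach_graph G t) f & f s = t.

(* The magma has carrier [M : set V], so that the elements of [M] are
   themselves vertices and an equality with a graph over [V] makes sense. *)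
Definition cayley (M : set V) (op : M -> M -> M) (Q : set M) (lab : Q -> A) :
    edge_set V A :=
  [set (val p, lab q, val (op p (val q))) | p in [set: M] & q in [set: Q]].

End Graphs.

Definition cancellative (T : Type) (op : T -> T -> T) :=
  (forall r p q, op r p = op r q -> p = q) /\
  (forall r p q, op p r = op q r -> p = q).

Definition submonoid (T : Type) (e : T) (op : T -> T -> T) (S : set T) :=
  S e /\ forall x y, S x -> S y -> S (op x y).

Definition generates_monoid (T : Type) (e : T) (op : T -> T -> T)
    (Q : set T) :=
  smallest (submonoid e op) Q = [set: T].

Definition cayley_of_cancellative_monoid (V A : Type) (G : edge_set V A) :=
  exists (M : set V) (e : M) (op : Monoid.law e) (Q : set M) (lab : Q -> A),
    [/\ cancellative op, generates_monoid e op Q, injective lab &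
        G = cayley op lab].

(* Main.v *)
Require Import Defs.
From Stdlib Require Import Relation_Operators Operators_Properties.
From HB Require Import structures.
From mathcomp Require Import all_boot.
From mathcomp Require Import boolp classical_sets functions.

(** In the Cayley graph of a cancellative monoid, the map [s x |-> t x] is an
    isomorphism from the part reachable from [s] to the part reachable from
    [t].  Conversely, let [r] be a root of [G].  Arc-symmetry provides for each
    vertex [s] an isomorphism [f_s] from [G] to the part reachable from [s],
    with [f_s r = s]; by determinism it is determined by the image of [r].
    Hence [f_s \o f_t = f_(f_s t)], so that [s * x := f_s x] is a monoid law
    with unit [r].  It is left-cancellative because [f_s] is injective,
    right-cancellative by co-determinism, and generated by the out-neighbours
    of [r], each labeled by its edge from [r]. *)

Set Implicit Arguments.
Unset Strict Implicit.
Unset Printing Implicit Defensive.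

Local Open Scope classical_set_scope.

(** * Reachability and reachable subgraphs *)

Section Reach.
Variables (V A : Type) (G : edge_set V A).

Lemma reach_ind_r s (P : V -> Prop) :
  P s -> (forall x a y, reach G s x -> P x -> G (x, a, y) -> P y) ->
  forall v, reach G s v -> P v.
Proof.
move=> Ps PS v /clos_rt_rtn1_iff; elim=> // y z [a Gyz] sy Py.
by apply: PS Gyz => //; apply/clos_rt_rtn1_iff.
Qed.

Lemma reach_edge s x a y : reach G s x -> G (x, a, y) -> reach G s y.
Proof. by move=> sx Gxy; apply: rt_trans sx _; apply: rt_step; exists a. Qed.

Lemma vertices_source x a y : G (x, a, y) -> vertices G x.
Proof. by move=> Gxy; exists a, y; left. Qed.

Lemma vertices_target x a y : G (x, a, y) -> vertices G y.
Proof. by move=> Gxy; exists a, x; right. Qed.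

Lemma reach_graphP s x a y :
  reach_graph G s (x, a, y) <-> reach G s x /\ G (x, a, y).
Proof.
split=> [[]//|[sx Gxy]]; split=> //=.
exact: reach_edge sx Gxy.
Qed.

Lemma vertices_reach_graph s v :
  vertices (reach_graph G s) v -> reach G s v.
Proof. by move=> [a [w [[]|[]]]]. Qed.

Lemma vertices_reach_graphW s v :
  vertices (reach_graph G s) v -> vertices G v.
Proof.
by move=> [a [w [[Gvw _ _]|[Gwv _ _]]]]; exists a, w; [left | right].
Qed.

(** Lets arc-symmetry at a root be read as an isomorphism from [G] itself. *)
Lemma reach_graph_root r :
  (forall s, vertices G s -> reach G r s) -> reach_graph G r = G.
Proof.
move=> root; apply/seteqP; split=> -[[x a] y]; first by move=> [].
by move=> Gxy; apply/reach_graphP; split=> //; apply/root/vertices_source/Gxy.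
Qed.

End Reach.

(** * Cayley graphs of cancellative monoids *)

Section CayleyGraph.
Variables (V A : Type) (M : set V) (e : M) (op : Monoid.law e).
Variables (Q : set M) (lab : Q -> A).
Hypotheses (cancel_op : cancellative op) (genQ : generates_monoid e op Q).
Hypothesis lab_inj : injective lab.

Let G := cayley op lab.

Lemma cayleyP v a w : G (v, a, w) <->
  exists p q, [/\ v = val p, a = lab q & w = val (op p (val q))].
Proof.
split=> [[p _ [q _ [<- <- <-]]]|[p [q [-> -> ->]]]]; first by exists p, q.
by exists p => //; exists q.
Qed.

Lemma cayley_reach_mul p x : reach G (val p) (val (op p x)).
Proof.
have: smallest (submonoid e op) Q x by rewrite genQ.
(* The set of these [y], with [p] quantified inside, is a submonoid containing [Q], hence contains
   [x]. *)
move=> /(_ [set y | forall p, reach G (val p) (val (op p y))]); apply; split.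
  split=> [{}p|y z ry rz {}p]; first by rewrite Monoid.mulm1; apply: rt_refl.
  by rewrite Monoid.mulmA; apply: rt_trans (ry p) (rz _).
move=> q Qq {}p; apply: rt_step.
have [q' <-] : exists q' : Q, val q' = q by exists (SigSub (mem_set Qq)).
by exists (lab q'); apply/cayleyP; exists p, q'.
Qed.

Lemma cayley_reachP p v : reach G (val p) v <-> exists x, v = val (op p x).
Proof.
split=> [|[x ->]]; last exact: cayley_reach_mul.
move: v; apply: reach_ind_r => [|_ a y _ [x ->] /cayleyP[p' [q [/val_inj <- _ ->]]]].
  by exists e; rewrite Monoid.mulm1.
by exists (op x (val q)); rewrite Monoid.mulmA.
Qed.

(** The right-hand side does not mention [s]: this is why translations from [s] to [t] preserve and
    reflect edges. *)
Lemma cayley_reach_edge s x a y :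
  reach_graph G (val s) (val (op s x), a, val (op s y)) <->
  exists2 q, a = lab q & y = op x (val q).
Proof.
split=> [/reach_graphP[_ /cayleyP[p [q [/val_inj <- -> /val_inj]]]]|].
  by rewrite -Monoid.mulmA => /(proj1 cancel_op) ->; exists q.
move=> [q -> ->]; apply/reach_graphP; split; first exact: cayley_reach_mul.
by apply/cayleyP; exists (op s x), q; rewrite Monoid.mulmA.
Qed.

Lemma cayley_simple : simple G.
Proof.
move=> s t a b /cayleyP[p [q [-> -> ->]]] /cayleyP[p' [q' [/val_inj <- ->]]].
by move=> /val_inj/(proj1 cancel_op)/val_inj ->.
Qed.

Lemma cayley_deterministic : deterministic G.
Proof.
move=> r a s t /cayleyP[p [q [-> -> ->]]].
by move=> /cayleyP[p' [q' [/val_inj <- /lab_inj <- ->]]].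
Qed.

Lemma cayley_codeterministic : codeterministic G.
Proof.
move=> r a s t /cayleyP[p [q [-> -> ->]]] /cayleyP[p' [q' [-> /lab_inj <-]]].
by move=> /val_inj/(proj2 cancel_op) ->.
Qed.

(** With no generator the graph would have no edge, hence no vertex, although [M] contains [e]. A
    generator gives every element an outgoing edge. *)
Hypothesis Q0 : Q !=set0.

Lemma cayley_reach_vertices s v :
  vertices (reach_graph G (val s)) v <-> exists x, v = val (op s x).
Proof.
split=> [sv|[x ->]]; first exact/cayley_reachP/vertices_reach_graph.
have [q Qq] := Q0; pose q' : Q := SigSub (mem_set Qq).
exists (lab q'), (val (op s (op x q))); left.
by apply/cayley_reach_edge; exists q'.
Qed.

Lemma cayley_verticesP v : vertices G v <-> M v.
Proof.
split=> [[a [w [/cayleyP[p [q [-> _ _]]]|/cayleyP[p [q [_ _ ->]]]]]]|Mv].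
- exact: set_mem (valP p).
- exact: set_mem (valP (op p (val q))).
pose p : M := SigSub (mem_set Mv).
apply: (@vertices_reach_graphW _ _ _ (val p)); apply/cayley_reach_vertices.
by exists e; rewrite Monoid.mulm1.
Qed.

Lemma cayley_rooted : rooted G.
Proof.
exists (val e) => [|s /cayley_verticesP Ms].
  by apply/cayley_verticesP; exact: set_mem (valP e).
have := cayley_reach_mul e (SigSub (mem_set Ms)).
by rewrite Monoid.mul1m.
Qed.

Lemma cayley_arc_symmetric : arc_symmetric G.
Proof.
have vert v : vertices G v -> exists p : M, val p = v.
  by move=> /cayley_verticesP/mem_set Mv; exists (SigSub Mv).
move=> _ _ /vert[s <-] /vert[t <-].
(* Left cancellation determines [x] from [s x], so [s x |-> t x] is well defined; elsewhere [f] is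
   the identity, an arbitrary default. *)
have /choice[f fE] v : exists w, forall x, v = val (op s x) -> w = val (op t x).
  have [[x ->]|nx] := pselect (exists x, v = val (op s x)).
    by exists (val (op t x)) => y /val_inj/(proj1 cancel_op) ->.
  by exists v => x vE; case: nx; exists x.
have {}fE x : f (val (op s x)) = val (op t x) by exact: fE.
exists f; last by have := fE e; rewrite !Monoid.mulm1.
split; first split.
- move=> _ /(cayley_reach_vertices s)[x ->].
  by apply/(cayley_reach_vertices t); exists x.
- move=> u v /set_mem/(cayley_reach_vertices s)[x ->].
  move=> /set_mem/(cayley_reach_vertices s)[y ->].
  by rewrite !fE => /val_inj/(proj1 cancel_op) ->.
- move=> _ /(cayley_reach_vertices t)[x ->]; exists (val (op s x)) => //.
  by apply/(cayley_reach_vertices s); exists x.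
move=> u a v /(cayley_reach_vertices s)[x ->] /(cayley_reach_vertices s)[y ->].
rewrite !fE; apply: iff_trans (cayley_reach_edge s x a y) _.
exact: iff_sym (cayley_reach_edge t x a y).
Qed.

End CayleyGraph.

(** * The monoid of a rooted arc-symmetric graph *)

Section MonoidOfGraph.
Variables (V A : Type) (G : edge_set V A) (r : V).
Hypotheses (Gr : vertices G r) (root : forall s, vertices G s -> reach G r s).
Hypotheses (simpleG : simple G) (detG : deterministic G).
Hypotheses (codetG : codeterministic G) (symG : arc_symmetric G).

Let edge_morphism (f : V -> V) :=
  forall x a y, G (x, a, y) -> G (f x, a, f y).

(** Agreement propagates forward along a path from [r], by determinism. *)
Lemma edge_morphism_eq f g :
  edge_morphism f -> edge_morphism g -> f r = g r ->
  forall x, vertices G x -> f x = g x.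
Proof.
move=> fG gG fgr x /root; move: x; apply: reach_ind_r => // y a z _ fgy Gyz.
by apply: (@detG (f y) a); [exact: fG | rewrite fgy; exact: gG].
Qed.

(** Agreement propagates backward along a path from [r], by co-determinism. *)
Lemma edge_morphism_eq_root f g :
  edge_morphism f -> edge_morphism g ->
  forall x, vertices G x -> f x = g x -> f r = g r.
Proof.
move=> fG gG x /root; move: x; apply: reach_ind_r => // y a z _ IH Gyz fgz.
by apply/IH/(@codetG (f z) a); [exact: fG | rewrite fgz; exact: gG].
Qed.

Lemma translation_exists s : vertices G s ->
  exists f : V -> V, [/\ f r = s, edge_morphism f,
    forall x, vertices G x -> vertices G (f x),
    {in vertices G &, injective f} &
    forall a y, G (s, a, y) -> exists2 q, G (r, a, q) & f q = y].
Proof.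
move=> Gs; have [f [[fV fI fS] fE] frs] := symG Gr Gs.
move: fV fI fS fE; rewrite (reach_graph_root root) => fV fI fS fE.
exists f; split=> // [x a y Gxy|x Gx|a y Gsy].
  have [] // := (fE x a y (vertices_source Gxy) (vertices_target Gxy)).1 Gxy.
  exact: vertices_reach_graphW (fV _ Gx).
have Hsy : reach_graph G s (s, a, y).
  by apply/reach_graphP; split=> //; apply: rt_refl.
have [q Gq qy] := fS _ (vertices_target Hsy).
by exists q => //; apply/fE => //; rewrite frs qy.
Qed.

Let M := vertices G.
Let e : M := SigSub (mem_set Gr).

Lemma cayley_monoid_of_graph : cayley_of_cancellative_monoid G.
Proof.
have MG (x : M) : vertices G (val x) := set_mem (valP x).
have /choice[f fP] (s : M) := translation_exists (MG s).
have fr s : f s r = val s by have [] := fP s.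
have fG s : edge_morphism (f s) by have [] := fP s.
have fM (s x : M) : f s (val x) \in M.
  by apply: mem_set; have [_ _ fsM _ _] := fP s; exact/fsM/MG.
have fI (s : M) : {in M &, injective (f s)} by have [] := fP s.
have fS (s : M) a y : G (val s, a, y) -> exists2 q, G (r, a, q) & f s q = y.
  by have [_ _ _ _] := fP s; apply.
pose op (s x : M) : M := SigSub (fM s x).
have opA : associative op.
  move=> s t x; apply: val_inj => /=.
  (* Both [f s \o f t] and [f (op s t)] send [r] to [op s t]. *)
  apply: (edge_morphism_eq (f := f s \o f t)) (MG x); last by rewrite /= !fr.
    by move=> y a z /(fG t)/(fG s).
  exact: fG.
have op1x : left_id e op.
  move=> x; apply: val_inj => /=.
  by apply: (edge_morphism_eq (g := id)) (MG x); [exact: fG | | exact: fr].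
have opx1 : right_id e op by move=> x; apply: val_inj; exact: fr.
pose opL := Monoid.isLaw.Build M e op opA op1x opx1.
pose law : Monoid.law e := HB.pack op opL.
pose Q : set M := [set q | exists a, G (r, a, val q)].
have /choice[lab labP] (q : Q) : exists a, G (r, a, val (val q)).
  exact: set_mem (valP q).
have edge_from_root a q (Grq : G (r, a, q)) :
    exists2 q' : Q, val (val q') = q & lab q' = a.
  pose q1 : M := SigSub (mem_set (vertices_target Grq)).
  have Qq1 : Q q1 by exists a.
  exists (SigSub (mem_set Qq1)) => //.
  exact: simpleG (labP (SigSub (mem_set Qq1))) Grq.
have GE : G = cayley law lab.
  apply/seteqP; split=> [[[p a] p'] Gpp'|_ [p _ [q _ <-]]].
    (* The edge out of [p] is the image under [f s] of an edge from [r] to some [q], so [p'] is the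
       product of [s] and [q]. *)
    pose s : M := SigSub (mem_set (vertices_source Gpp')).
    have [_ /edge_from_root[q <- <-] <-] := fS s a p' Gpp'.
    by exists s => //; exists q.
  by rewrite -(fr p); exact: fG.
exists M, e, law, Q, lab; split=> //.
- split=> s x y => [/(congr1 val)/= /fI xy|/(congr1 val)/= sxy].
    by apply/val_inj/xy; exact: valP.
  (* The maps [f x] and [f y] agree at [s], hence at [r]. *)
  apply: val_inj; rewrite -(fr x) -(fr y).
  by apply: edge_morphism_eq_root (MG s) sxy; exact: fG.
- apply/seteqP; split=> // x _ S [[Se Sop] QS].
  (* Follow a path from [r]: it starts at [e], and each edge multiplies on the right by an element
     of [Q]. *)
  suff reachS v : reach G r v -> forall y : M, val y = v -> S y.
    exact: reachS (root (MG x)) x erefl.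
  move: v; apply: reach_ind_r => [y yr|u a v _ IH Guv y yv].
    by rewrite (_ : y = e) //; apply: val_inj.
  move: Guv; rewrite {1}GE => -[p _ [q _ [pu _ qv]]].
  rewrite (_ : y = law p (val q)); last by apply: val_inj; rewrite yv -qv.
  by apply: Sop; [exact: IH | apply: QS; exact: set_mem (valP q)].
- move=> q q' qq'; apply/val_inj/val_inj.
  by apply: detG (labP q) _; rewrite qq'; exact: labP.
Qed.

End MonoidOfGraph.

Theorem theorem3p7 (V A : Type) (G : edge_set V A) (hG : G !=set0) :
  cayley_of_cancellative_monoid G <->
  [/\ rooted G, simple G, deterministic G, codeterministic G &
      arc_symmetric G].
Proof.
split=> [[M [e [op [Q [lab [opI genQ labI GE]]]]]]|].
  have Q0 : Q !=set0.
    move: hG; rewrite GE => -[_ [p _ [q _ _]]].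
    by exists (val q); exact: set_mem (valP q).
  rewrite GE; split.
  - exact: cayley_rooted.
  - exact: cayley_simple.
  - exact: cayley_deterministic.
  - exact: cayley_codeterministic.
  - exact: cayley_arc_symmetric.
move=> [[r Gr root] simpleG detG codetG symG].
exact: cayley_monoid_of_graph Gr root simpleG detG codetG symG.
Qed.
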